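(* Let $H$ be a Hopf algebra, let $S$ be an $H$-comodule algebra and let $M$ be an $(H,S)$-Hopf module. There is an isomorphism of pointed sets $$\mathrm{D}^1(H,M)\cong\mathrm{Tors}(M).$$
   Context: $k$ is a commutative unital ring, $\otimes=\otimes_k$; algebras are associative unital $k$-algebras; modules are right modules. $H$ is a Hopf algebra over $k$, finite-dimensional over $k$ (finitely generated projective as a $k$-module), with comultiplication $\Delta_H$ and counit $\varepsilon_H$. An $H$-comodule algebra is an algebra $S$ with a right $H$-coaction $\Delta_S:S\to S\otimes H$ that is an algebra morphism. An $(H,S)$-Hopf module is an $S$-module $M$ that is also a right $H$-comodule via $\Delta_M:M\to M\otimes H$, with $\Delta_M(ms)=\Delta_M(m)\Delta_S(s)$ for all $m\in M,s\in S$. A morphism of $(H,S)$-Hopf modules is an $S$-linear map commuting with the $H$-coactions. Descent cohomology set. $\mathrm{C}^1(H,M)$ is the set of $k$-linear maps $F:M\to M\otimes H$ such that $F(ms)=F(m)\Delta_S(s)$ for all $m\in M,s\in S$, $(\mathrm{id}_M\otimes\varepsilon_H)\circ F=\mathrm{id}_M$ and $(F\otimes\mathrm{id}_H)\circ F=(\mathrm{id}_M\otimes\Delta_H)\circ F$. The group $\mathrm{Aut}_S(M)$ of $S$-linear automorphisms acts on the right on it by $F\leftharpoonup f=(f^{-1}\otimes\mathrm{id}_H)\circ F\circ f$; $\mathrm{D}^1(H,M)$ is the set of orbits, pointed by the class of $\Delta_M$. Torsors. An $M$-torsor is a triple $(X,\Delta_X,\beta)$, where $X$ is an $S$-module, $\Delta_X:X\to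 X\otimes H$ is a map conferring on $X$ a structure of $(H,S)$-Hopf module and $\beta:M\to X$ is an $S$-linear isomorphism. Two $M$-torsors $(X,\Delta_X,\beta)$ and $(X',\Delta_{X'},\beta')$ are equivalent if there exists $f\in\mathrm{Aut}_S(M)$ such that $\beta\circ f\circ\beta'^{-1}:X'\to X$ is a morphism of $(H,S)$-Hopf modules. $\mathrm{Tors}(M)$ is the set of equivalence classes of $M$-torsors, pointed by the class of $(M,\Delta_M,\mathrm{id}_M)$. *)

(* Defs.v *)
From HB Require Import structures.
From mathcomp Require Import all_boot all_algebra.
From mathcomp Require Import boolp.
From Stdlib Require Import RelationClasses.

Set Implicit Arguments.
Unset Strict Implicit.
Unset Printing Implicit Defensive.

Import GRing.Theory.
Local Open Scope ring_scope.
Local Open Scope quotient_scope.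

Section Bilinear.
Variables (k : comPzRingType) (M N P : lmodType k) (f : M -> N -> P).

Definition bilin : Prop :=
  (forall n, linear (f^~ n)) /\ (forall m, linear (f m)).

Hypothesis fB : bilin.

Lemma bilin0l n : f 0 n = 0.
Proof. by have := fB.1 n (-1) 0 0; rewrite scaler0 addr0 scaleN1r addNr. Qed.
Lemma bilin0r m : f m 0 = 0.
Proof. by have := fB.2 m (-1) 0 0; rewrite scaler0 addr0 scaleN1r addNr. Qed.
Lemma bilinDl m m' n : f (m + m') n = f m n + f m' n.
Proof. by have := fB.1 n 1 m m'; rewrite !scale1r. Qed.
Lemma bilinDr m n n' : f m (n + n') = f m n + f m n'.
Proof. by have := fB.2 m 1 n n'; rewrite !scale1r. Qed.

Lemma bilinZl a m n : f (a *: m) n = a *: f m n.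
Proof. by have := fB.1 n a m 0; rewrite /= bilin0l !addr0. Qed.
Lemma bilinZr a m n : f m (a *: n) = a *: f m n.
Proof. by have := fB.2 m a n 0; rewrite bilin0r !addr0. Qed.
End Bilinear.


(* MathComp has no tensor product of modules over a commutative ring.  An     *)
(* element of tensor M N is a finite formal sum of pairs (m, n), modulo the   *)
(* least congruence containing biadditivity and k-balancedness.               *)

Section Tensor.
Variables (k : comPzRingType) (M N : lmodType k).

Inductive tensor_eq : seq (M * N) -> seq (M * N) -> Prop :=
| teq_refl s : tensor_eq s s
| teq_sym s t : tensor_eq s t -> tensor_eq t s
| teq_trans s t u : tensor_eq s t -> tensor_eq t u -> tensor_eq s u
| teq_cat s s' t t' :
    tensor_eq s s' -> tensor_eq t t' -> tensor_eq (s ++ t) (s' ++ t')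
| teq_catC s t : tensor_eq (s ++ t) (t ++ s)
| teq_addl m m' n : tensor_eq [:: (m + m', n)] [:: (m, n); (m', n)]
| teq_addr m n n' : tensor_eq [:: (m, n + n')] [:: (m, n); (m, n')]
| teq_scale (a : k) m n : tensor_eq [:: (a *: m, n)] [:: (m, a *: n)]
| teq_0 n : tensor_eq [:: (0, n)] [::].

Definition tensor_eqb (s t : seq (M * N)) : bool := `[< tensor_eq s t >].

Lemma tensor_eqb_equiv : equiv_class_of tensor_eqb.
Proof.
split=> [s|s t|s t u].
- by apply/asboolP; apply: teq_refl.
- by apply/asboolP/asboolP; apply: teq_sym.
- by move=> /asboolP h1 /asboolP h2; apply/asboolP; apply: teq_trans h1 h2.
Qed.

Canonical tensor_equiv := EquivRelPack tensor_eqb_equiv.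

Definition tensor := {eq_quot tensor_equiv}.

HB.instance Definition _ := Choice.on tensor.

Definition tensor_sum (s : seq (M * N)) : tensor := \pi_tensor s.
Definition tensor_repr (x : tensor) : seq (M * N) := repr x.

Lemma tensor_sumP s t : tensor_sum s = tensor_sum t <-> tensor_eq s t.
Proof.
by split=> [/eqmodP/asboolP //|h]; apply/eqmodP/asboolP.
Qed.

Lemma tensor_reprK x : tensor_sum (tensor_repr x) = x.
Proof. exact: reprK. Qed.

Lemma tensor_sum_surj x : exists s, x = tensor_sum s.
Proof. by exists (tensor_repr x); rewrite tensor_reprK. Qed.

Lemma tensor_repr_sum s : tensor_eq (tensor_repr (tensor_sum s)) s.
Proof. by apply/tensor_sumP; rewrite tensor_reprK. Qed.

Definition tensor_zero : tensor := tensor_sum [::].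
Definition tensor_add (x y : tensor) : tensor :=
  tensor_sum (tensor_repr x ++ tensor_repr y).
Definition tensor_scale (a : k) (x : tensor) : tensor :=
  tensor_sum [seq (a *: p.1, p.2) | p <- tensor_repr x].
Definition tensor_opp (x : tensor) : tensor := tensor_scale (-1) x.

Lemma tensor_addE s t :
  tensor_add (tensor_sum s) (tensor_sum t) = tensor_sum (s ++ t).
Proof. by apply/tensor_sumP; apply: teq_cat; apply: tensor_repr_sum. Qed.

Lemma tensor_eq_map (a : k) s t : tensor_eq s t ->
  tensor_eq [seq (a *: p.1, p.2) | p <- s] [seq (a *: p.1, p.2) | p <- t].
Proof.
elim=> {s t} /=.
- by move=> s; apply: teq_refl.
- by move=> s t _; apply: teq_sym.
- by move=> s t u _ h1 _; apply: teq_trans h1.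
- by move=> s s' t t' _ h1 _ h2; rewrite !map_cat; apply: teq_cat.
- by move=> s t; rewrite !map_cat; apply: teq_catC.
- by move=> m m' n; rewrite scalerDr; apply: teq_addl.
- by move=> m n n'; apply: teq_addr.
- move=> b m n; rewrite scalerA mulrC -scalerA.
  exact: teq_scale.
- by move=> n; rewrite scaler0; apply: teq_0.
Qed.

Lemma tensor_scaleE a s :
  tensor_scale a (tensor_sum s) = tensor_sum [seq (a *: p.1, p.2) | p <- s].
Proof. by apply/tensor_sumP/tensor_eq_map; apply: tensor_repr_sum. Qed.

Lemma tensor_addA : associative tensor_add.
Proof.
move=> x y z; have [s ->] := tensor_sum_surj x.
have [t ->] := tensor_sum_surj y; have [u ->] := tensor_sum_surj z.
by rewrite !tensor_addE catA.
Qed.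

Lemma tensor_addC : commutative tensor_add.
Proof.
move=> x y; have [s ->] := tensor_sum_surj x.
have [t ->] := tensor_sum_surj y.
by rewrite !tensor_addE; apply/tensor_sumP; apply: teq_catC.
Qed.

Lemma tensor_add0 : left_id tensor_zero tensor_add.
Proof.
by move=> x; have [s ->] := tensor_sum_surj x; rewrite tensor_addE.
Qed.

Lemma tensor_scale_0 x : tensor_scale 0 x = tensor_zero.
Proof.
have [s ->] := tensor_sum_surj x; rewrite tensor_scaleE; apply/tensor_sumP.
elim: s => [|[m n] s ih] /=; first exact: teq_refl.
rewrite -cat1s -[[::]]cat0s; apply: teq_cat ih.
by rewrite scale0r; apply: teq_0.
Qed.

Lemma tensor_scaleDl x a b :
  tensor_scale (a + b) x = tensor_add (tensor_scale a x) (tensor_scale b x).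
Proof.
have [s ->] := tensor_sum_surj x; rewrite !tensor_scaleE.
have cE p t : tensor_sum (p :: t) = tensor_add (tensor_sum [:: p]) (tensor_sum t).
  by rewrite tensor_addE.
elim: s => [|[m n] s ih] /=; first by rewrite tensor_addE.
rewrite cE ih (cE (a *: m, n)) (cE (b *: m, n)).
have -> : tensor_sum [:: ((a + b) *: m, n)]
    = tensor_add (tensor_sum [:: (a *: m, n)]) (tensor_sum [:: (b *: m, n)]).
  by rewrite tensor_addE scalerDl; apply/tensor_sumP; apply: teq_addl.
rewrite -!tensor_addA; congr tensor_add.
by rewrite !tensor_addA; congr tensor_add; apply: tensor_addC.
Qed.

Lemma tensor_scale1 : left_id 1 tensor_scale.
Proof.
move=> x; have [s ->] := tensor_sum_surj x; rewrite tensor_scaleE.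
by congr tensor_sum; rewrite -[RHS]map_id; apply: eq_map => -[m n] /=;
  rewrite scale1r.
Qed.

Lemma tensor_addN : left_inverse tensor_zero tensor_opp tensor_add.
Proof.
move=> x; rewrite -(tensor_scale_0 x) -(addNr 1) tensor_scaleDl.
by rewrite tensor_scale1.
Qed.

HB.instance Definition _ :=
  GRing.isZmodule.Build tensor tensor_addA tensor_addC tensor_add0 tensor_addN.

Lemma tensor_scaleA a b x :
  tensor_scale a (tensor_scale b x) = tensor_scale (a * b) x.
Proof.
have [s ->] := tensor_sum_surj x; rewrite !tensor_scaleE -map_comp.
by congr tensor_sum; apply: eq_map => -[m n] /=; rewrite scalerA.
Qed.

Lemma tensor_scaleDr : right_distributive tensor_scale +%R.
Proof.
move=> a x y; have [s ->] := tensor_sum_surj x.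
have [t ->] := tensor_sum_surj y.
change (tensor_scale a (tensor_add (tensor_sum s) (tensor_sum t)) = tensor_add
  (tensor_scale a (tensor_sum s)) (tensor_scale a (tensor_sum t))).
by rewrite tensor_addE !tensor_scaleE tensor_addE map_cat.
Qed.

HB.instance Definition _ := GRing.Zmodule_isLmodule.Build k tensor
  tensor_scaleA tensor_scale1 tensor_scaleDr tensor_scaleDl.

Definition tens (m : M) (n : N) : tensor := tensor_sum [:: (m, n)].

Lemma tensor_sumE s : tensor_sum s = \sum_(p <- s) tens p.1 p.2.
Proof.
elim: s => [|[m n] s ih]; first by rewrite big_nil.
by rewrite big_cons -ih -cat1s -tensor_addE.
Qed.

Lemma tensor_ind (P : tensor -> Prop) :
  P 0 -> (forall x y, P x -> P y -> P (x + y)) ->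
  (forall m n, P (tens m n)) -> forall x, P x.
Proof.
move=> P0 PD Pt x; have [s ->] := tensor_sum_surj x.
by rewrite tensor_sumE; apply: big_ind.
Qed.

Lemma tens_bilin : bilin tens.
Proof.
have zl a m n : tens (a *: m) n = a *: tens m n.
  by rewrite -[RHS]/(tensor_scale _ _) tensor_scaleE.
split=> [n a m m' | m a n n'].
- rewrite -zl -[RHS]/(tensor_add _ _) tensor_addE.
  by apply/tensor_sumP; apply: teq_addl.
- rewrite -zl -[RHS]/(tensor_add _ _) tensor_addE; apply/tensor_sumP.
  apply: teq_trans (teq_addr _ _ _) _.
  apply: (@teq_cat [:: _] [:: _] [:: _] [:: _]); last exact: teq_refl.
  exact/teq_sym/teq_scale.
Qed.

(* The map M (x) N -> P induced by f; it does not depend on the chosen        *)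
(* representative when f is bilinear (tensor_liftE).                          *)
Definition tensor_lift (P : lmodType k) (f : M -> N -> P) (x : tensor) : P :=
  \sum_(p <- tensor_repr x) f p.1 p.2.

Section Lift.
Variables (P : lmodType k) (f : M -> N -> P).
Hypothesis fB : bilin f.

Lemma tensor_lift_eq s t : tensor_eq s t ->
  \sum_(p <- s) f p.1 p.2 = \sum_(p <- t) f p.1 p.2.
Proof.
elim=> {s t} //=.
- by move=> s t u _ -> _ ->.
- by move=> s s' t t' _ h1 _ h2; rewrite !big_cat /= h1 h2.
- by move=> s t; rewrite !big_cat /= addrC.
- by move=> m m' n; rewrite !big_cons !big_nil !addr0 /= (bilinDl fB).
- by move=> m n n'; rewrite !big_cons !big_nil !addr0 /= (bilinDr fB).
- by move=> a m n; rewrite !big_cons !big_nil !addr0 /= (bilinZl fB) (bilinZr fB).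
- by move=> n; rewrite big_cons !big_nil addr0 /= (bilin0l fB).
Qed.

Lemma tensor_lift_sum s :
  tensor_lift f (tensor_sum s) = \sum_(p <- s) f p.1 p.2.
Proof. by apply: tensor_lift_eq; apply: tensor_repr_sum. Qed.

Lemma tensor_liftE m n : tensor_lift f (tens m n) = f m n.
Proof. by rewrite tensor_lift_sum big_seq1. Qed.

Lemma tensor_lift_linear : linear (tensor_lift f).
Proof.
move=> a x y; have [s ->] := tensor_sum_surj x.
have [t ->] := tensor_sum_surj y.
rewrite -[a *: _]/(tensor_scale _ _) tensor_scaleE.
rewrite -[_ + _ in LHS]/(tensor_add _ _) tensor_addE !tensor_lift_sum.
rewrite big_cat big_map scaler_sumr /=.
by congr (_ + _); apply: eq_bigr => p _; rewrite (bilinZl fB).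
Qed.
End Lift.

End Tensor.

Arguments tens {k M N} m n.
Notation "m ⊗ n" := (tens m n) (at level 40, left associativity) : ring_scope.

Section TensorMaps.
Variable k : comPzRingType.

Lemma tensor_linear_ext (M N P : lmodType k) (f g : {linear tensor M N -> P}) :
  (forall m n, f (m ⊗ n) = g (m ⊗ n)) -> f =1 g.
Proof.
move=> h; apply: tensor_ind => [|x y hx hy|//]; first by rewrite !linear0.
by rewrite !linearD hx hy.
Qed.

Section Map.
Variables (M M' N N' : lmodType k).
Variables (f : {linear M -> M'}) (g : {linear N -> N'}).

Definition tensor_map : tensor M N -> tensor M' N' :=
  tensor_lift (fun m n => f m ⊗ g n).

Lemma tensor_map_bilin : bilin (fun m n => f m ⊗ g n).
Proof.
split=> [n a m m'|m a n n']; rewrite linearP.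
- exact: (tens_bilin M' N').1.
- exact: (tens_bilin M' N').2.
Qed.

HB.instance Definition _ := GRing.isLinear.Build k (tensor M N) (tensor M' N') _
  tensor_map (tensor_lift_linear tensor_map_bilin).

Lemma tensor_mapE m n : tensor_map (m ⊗ n) = f m ⊗ g n.
Proof. exact: tensor_liftE tensor_map_bilin _ _. Qed.
End Map.

Section Map2.
Variables (M A P N B Q : lmodType k) (f : M -> A -> P) (g : N -> B -> Q).

Definition tensor_map2 (x : tensor M N) (y : tensor A B) : tensor P Q :=
  tensor_lift (fun m n => tensor_lift (fun a b => f m a ⊗ g n b) y) x.

Hypotheses (fB : bilin f) (gB : bilin g).

Let inner m n : bilin (fun a b => f m a ⊗ g n b).
Proof.
split=> [b c a a'|a c b b'].
- by rewrite fB.2; apply: (tens_bilin P Q).1.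
- by rewrite gB.2; apply: (tens_bilin P Q).2.
Qed.

Let outer y : bilin (fun m n => tensor_lift (fun a b => f m a ⊗ g n b) y).
Proof.
have [s ->] := tensor_sum_surj y.
have lE m n := tensor_lift_sum (inner m n) s.
split=> [n c m m'|m c n n']; rewrite !lE scaler_sumr -big_split /=;
  apply: eq_bigr => p _.
- by rewrite fB.1; apply: (tens_bilin P Q).1.
- by rewrite gB.1; apply: (tens_bilin P Q).2.
Qed.

Lemma tensor_map2E m n a b :
  tensor_map2 (m ⊗ n) (a ⊗ b) = f m a ⊗ g n b.
Proof.
by rewrite /tensor_map2 (tensor_liftE (outer _)) (tensor_liftE (inner _ _)).
Qed.

Lemma tensor_map2_bilin : bilin tensor_map2.
Proof.
split=> [y|x c y y']; first exact: tensor_lift_linear (outer y).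
have [s ->] := tensor_sum_surj x; rewrite /tensor_map2.
rewrite !(tensor_lift_sum (outer _)) scaler_sumr -big_split /=.
by apply: eq_bigr => p _; rewrite (tensor_lift_linear (inner _ _)).
Qed.
End Map2.

Section Assoc.
Variables (M N P : lmodType k).

Definition tensor_assoc : tensor (tensor M N) P -> tensor M (tensor N P) :=
  tensor_lift (fun x p => tensor_lift (fun m n => m ⊗ (n ⊗ p)) x).

Let inner p : bilin (fun m n => m ⊗ (n ⊗ p) : tensor M (tensor N P)).
Proof.
split=> [n c m m'|m c n n']; first exact: (tens_bilin M (tensor N P)).1.
by rewrite (tens_bilin N P).1; apply: (tens_bilin M (tensor N P)).2.
Qed.

Let outer : bilin (fun (x : tensor M N) p =>
    tensor_lift (fun m n => m ⊗ (n ⊗ p) : tensor M (tensor N P)) x).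
Proof.
split=> [p|x c p p']; first exact: tensor_lift_linear (inner p).
have [s ->] := tensor_sum_surj x.
rewrite !(tensor_lift_sum (inner _)) scaler_sumr -big_split /=.
apply: eq_bigr => q _; rewrite (tens_bilin N P).2.
exact: (tens_bilin M (tensor N P)).2.
Qed.

HB.instance Definition _ := GRing.isLinear.Build k
  (tensor (tensor M N) P) (tensor M (tensor N P)) _
  tensor_assoc (tensor_lift_linear outer).

Lemma tensor_assocE m n p : tensor_assoc (m ⊗ n ⊗ p) = m ⊗ (n ⊗ p).
Proof.
by rewrite /tensor_assoc (tensor_liftE outer) (tensor_liftE (inner _)).
Qed.
End Assoc.

Lemma tens0l (M N : lmodType k) (n : N) : (0 : M) ⊗ n = 0.
Proof. exact: bilin0l (tens_bilin M N) n. Qed.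
Lemma tensDl (M N : lmodType k) (x y : M) (n : N) : (x + y) ⊗ n = x ⊗ n + y ⊗ n.
Proof. exact: bilinDl (tens_bilin M N) x y n. Qed.

Lemma tensor_assoc_nat (M M' N N' P P' : lmodType k) (f : {linear M -> M'})
    (g : {linear N -> N'}) (h : {linear P -> P'}) x :
  tensor_assoc (tensor_map (tensor_map f g) h x)
    = tensor_map f (tensor_map g h) (tensor_assoc x).
Proof.
elim/tensor_ind: x => [|x x' hx hy|a p]; first by rewrite !linear0.
  by rewrite !linearD /= hx hy.
elim/tensor_ind: a => [|x x' hx hy|m n].
- by rewrite tens0l !linear0.
- by rewrite tensDl !linearD /= hx hy.
by rewrite tensor_mapE tensor_assocE /= !tensor_mapE tensor_assocE /= tensor_mapE.
Qed.

Lemma eq_tensor_map (M M' N N' : lmodType k) (f f' : {linear M -> M'})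
    (g g' : {linear N -> N'}) :
  f =1 f' -> g =1 g' -> tensor_map f g =1 tensor_map f' g'.
Proof.
move=> hf hg; apply: tensor_linear_ext => m n.
by rewrite /= !tensor_mapE hf hg.
Qed.

Lemma tensor_map_id (M N : lmodType k) : tensor_map (@idfun M) (@idfun N) =1 id.
Proof.
by apply: (@tensor_linear_ext M N _ _ idfun) => m n; rewrite /= tensor_mapE.
Qed.

Lemma tensor_map_comp (M M' M'' N N' N'' : lmodType k)
    (f : {linear M -> M'}) (f' : {linear M' -> M''})
    (g : {linear N -> N'}) (g' : {linear N' -> N''}) x :
  tensor_map f' g' (tensor_map f g x) = tensor_map (f' \o f) (g' \o g) x.
Proof.
elim/tensor_ind: x => [|x x' hx hy|m n]; first by rewrite !linear0.
  by rewrite !linearD /= hx hy.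
by rewrite !tensor_mapE.
Qed.

(* id (x) e : M (x) C -> M (x) k = M and e (x) id : C (x) M -> k (x) M = M.   *)
Section Contract.
Variables (M C : lmodType k) (e : {scalar C}).

Definition tensor_contractr : tensor M C -> M :=
  tensor_lift (fun m c => e c *: m).
Definition tensor_contractl : tensor C M -> M :=
  tensor_lift (fun c m => e c *: m).

Let contractr_bilin : bilin (fun (m : M) c => e c *: m).
Proof.
split=> [c a m m'|m a c c']; last by rewrite linearP scalerDl scalerA.
by rewrite scalerDr !scalerA mulrC.
Qed.

Let contractl_bilin : bilin (fun c (m : M) => e c *: m).
Proof. by case: contractr_bilin. Qed.

HB.instance Definition _ := GRing.isLinear.Build k (tensor M C) M _
  tensor_contractr (tensor_lift_linear contractr_bilin).
HB.instance Definition _ := GRing.isLinear.Build k (tensor C M) M _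
  tensor_contractl (tensor_lift_linear contractl_bilin).

Lemma tensor_contractrE m c : tensor_contractr (m ⊗ c) = e c *: m.
Proof. exact: tensor_liftE contractr_bilin _ _. Qed.
Lemma tensor_contractlE c m : tensor_contractl (c ⊗ m) = e c *: m.
Proof. exact: tensor_liftE contractl_bilin _ _. Qed.
End Contract.

Lemma tensor_contractr_nat (M N C : lmodType k) (e : {scalar C})
    (f : {linear M -> N}) x :
  tensor_contractr e (tensor_map f idfun x) = f (tensor_contractr e x).
Proof.
elim/tensor_ind: x => [|x x' hx hy|m c]; first by rewrite !linear0.
  by rewrite !linearD /= hx hy.
by rewrite tensor_mapE !tensor_contractrE linearZ.
Qed.

End TensorMaps.

(* MathComp's lalgType and algType exclude the zero ring, while the algebras  *)
(* here, and the tensor product of two of them, may be zero.                  *)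
HB.mixin Record isPzAlgebra (k : comPzRingType) A of GRing.Lmodule k A := {
  amul : A -> A -> A;
  aone : A;
  amul_bilin : bilin amul;
  amulA : associative amul;
  amul1l : left_id aone amul;
  amul1r : right_id aone amul
}.

#[short(type="pzAlgType")]
HB.structure Definition PzAlgebra (k : comPzRingType) :=
  {A of GRing.Lmodule k A & isPzAlgebra k A}.

Arguments aone {k} s : rename.

(* The k-module structure m a of a right A-module M is m (a 1_A), as follows  *)
(* from bilinearity and ract1.                                                *)
HB.mixin Record isRightModule (k : comPzRingType) (A : pzAlgType k) M
    of GRing.Lmodule k M := {
  ract : M -> A -> M;
  ract_bilin : bilin ract;
  ract1 : forall m, ract m (aone A) = m;
  ractM : forall m a b, ract m (amul a b) = ract (ract m a) b
}.

#[short(type="rmodType")]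
HB.structure Definition RightModule (k : comPzRingType) (A : pzAlgType k) :=
  {M of GRing.Lmodule k M & isRightModule k A M}.

Section TensorAlgebra.
Variables (k : comPzRingType) (A B : pzAlgType k).

Definition tensor_one : tensor A B := aone A ⊗ aone B.
Definition tensor_mul : tensor A B -> tensor A B -> tensor A B :=
  tensor_map2 amul amul.

Lemma tensor_mulE a b a' b' :
  tensor_mul (a ⊗ b) (a' ⊗ b') = amul a a' ⊗ amul b b'.
Proof. exact: tensor_map2E amul_bilin amul_bilin _ _ _ _. Qed.

Lemma tensor_mul_bilin : bilin tensor_mul.
Proof. exact: tensor_map2_bilin amul_bilin amul_bilin. Qed.

Let mB := tensor_mul_bilin.

Lemma tensor_mulA : associative tensor_mul.
Proof.
move=> x y z; elim/tensor_ind: x => [|x x' hx hy|a b].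
- by rewrite !(bilin0l mB).
- by rewrite !(bilinDl mB) hx hy.
elim/tensor_ind: y => [|x y hx hy|c d].
- by rewrite (bilin0l mB) !(bilin0r mB) (bilin0l mB).
- by rewrite (bilinDl mB) !(bilinDr mB) (bilinDl mB) hx hy.
elim/tensor_ind: z => [|x y hx hy|c' d'].
- by rewrite !(bilin0r mB).
- by rewrite !(bilinDr mB) hx hy.
by rewrite !tensor_mulE !amulA.
Qed.

Lemma tensor_mul1l : left_id tensor_one tensor_mul.
Proof.
elim/tensor_ind => [|x y hx hy|a b]; first by rewrite (bilin0r mB).
  by rewrite (bilinDr mB) hx hy.
by rewrite tensor_mulE !amul1l.
Qed.

Lemma tensor_mul1r : right_id tensor_one tensor_mul.
Proof.
elim/tensor_ind => [|x y hx hy|a b]; first by rewrite (bilin0l mB).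
  by rewrite (bilinDl mB) hx hy.
by rewrite tensor_mulE !amul1r.
Qed.

HB.instance Definition _ := isPzAlgebra.Build k (tensor A B)
  tensor_mul_bilin tensor_mulA tensor_mul1l tensor_mul1r.

End TensorAlgebra.

Section TensorModule.
Variables (k : comPzRingType) (A B : pzAlgType k).
Variable M : rmodType A.

Definition tensor_ract : tensor M B -> tensor A B -> tensor M B :=
  tensor_map2 ract amul.

Lemma tensor_ractE m n a b :
  tensor_ract (m ⊗ n) (a ⊗ b) = ract m a ⊗ amul n b.
Proof. exact: tensor_map2E ract_bilin amul_bilin _ _ _ _. Qed.

Lemma tensor_ract_bilin : bilin tensor_ract.
Proof. exact: tensor_map2_bilin ract_bilin amul_bilin. Qed.

Lemma tensor_ract1 x : tensor_ract x (aone (tensor A B)) = x.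
Proof.
elim/tensor_ind: x => [|x y hx hy|m n].
- exact: bilin0l tensor_ract_bilin _.
- by rewrite (bilinDl tensor_ract_bilin) hx hy.
- by rewrite tensor_ractE ract1 amul1r.
Qed.

Lemma tensor_ractM x a b :
  tensor_ract x (amul a b) = tensor_ract (tensor_ract x a) b.
Proof.
have rB := tensor_ract_bilin.
have mB : bilin (amul : tensor A B -> _) := amul_bilin.
elim/tensor_ind: x => [|x y hx hy|m n]; first by rewrite !(bilin0l rB).
  by rewrite !(bilinDl rB) hx hy.
elim/tensor_ind: a => [|x y hx hy|c d].
- by rewrite (bilin0l mB) !(bilin0r rB) (bilin0l rB).
- by rewrite (bilinDl mB) !(bilinDr rB) (bilinDl rB) hx hy.
elim/tensor_ind: b => [|x y hx hy|c' d'].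
- by rewrite (bilin0r mB) !(bilin0r rB).
- by rewrite (bilinDr mB) !(bilinDr rB) hx hy.
by rewrite [amul _ _]tensor_mulE !tensor_ractE ractM amulA.
Qed.

HB.instance Definition _ := isRightModule.Build k (tensor A B) (tensor M B)
  tensor_ract_bilin tensor_ract1 tensor_ractM.
End TensorModule.

Definition counital (k : comPzRingType) (C M : lmodType k) (eps : {scalar C})
    (D : M -> tensor M C) : Prop :=
  forall m, tensor_contractr eps (D m) = m.

Definition coassociative (k : comPzRingType) (C M : lmodType k)
    (comul : {linear C -> tensor C C}) (D : {linear M -> tensor M C}) : Prop :=
  forall m, tensor_assoc (tensor_map D idfun (D m)) = tensor_map idfun comul (D m).

HB.mixin Record isCoalgebra (k : comPzRingType) C of GRing.Lmodule k C := {
  comul : {linear C -> tensor C C};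
  counit : {scalar C};
  comul_coassoc : coassociative comul comul;
  comul_counitr : counital counit comul;
  comul_counitl : forall c, tensor_contractl counit (comul c) = c
}.

#[short(type="coalgType")]
HB.structure Definition Coalgebra (k : comPzRingType) :=
  {C of GRing.Lmodule k C & isCoalgebra k C}.

Arguments comul {k} s : rename.
Arguments counit {k} s : rename.

Definition algebra_morphism (k : comPzRingType) (A B : pzAlgType k)
    (f : A -> B) : Prop :=
  f (aone A) = aone B /\ {morph f : x y / amul x y}.

(* comul and counit are algebra morphisms and id has the convolution inverse  *)
(* antipode.                                                                  *)
HB.mixin Record isHopfAlgebra (k : comPzRingType) H
    of PzAlgebra k H & Coalgebra k H := {
  comul_morphism : algebra_morphism (comul H);
  counit1 : counit H (aone H) = 1;
  counitM : forall x y : H, counit H (amul x y) = counit H x * counit H y;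
  antipode : {linear H -> H};
  antipodel : forall h : H,
    tensor_lift (fun x y => amul (antipode x) y) (comul H h)
      = counit H h *: aone H;
  antipoder : forall h : H,
    tensor_lift (fun x y => amul x (antipode y)) (comul H h)
      = counit H h *: aone H
}.

#[short(type="hopfAlgType")]
HB.structure Definition HopfAlgebra (k : comPzRingType) :=
  {H of PzAlgebra k H & Coalgebra k H & isHopfAlgebra k H}.

HB.mixin Record isComoduleAlgebra (k : comPzRingType) (H : hopfAlgType k) S
    of PzAlgebra k S := {
  acoact : {linear S -> tensor S H};
  acoact_coassoc : coassociative (comul H) acoact;
  acoact_counit : counital (counit H) acoact;
  acoact_morphism : algebra_morphism acoact
}.

#[short(type="comodAlgType")]
HB.structure Definition ComoduleAlgebra (k : comPzRingType) (H : hopfAlgType k) :=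
  {S of PzAlgebra k S & isComoduleAlgebra k H S}.

Arguments acoact {k H} s : rename.

Definition right_linear (k : comPzRingType) (A : pzAlgType k)
    (M N : rmodType A) (f : M -> N) : Prop :=
  forall m a, f (ract m a) = ract (f m) a.

(* F(m s) = F(m) Delta_S(s), for the (S (x) H)-module M (x) H. *)
Definition hopf_compatible (k : comPzRingType) (H : hopfAlgType k)
    (S : comodAlgType H) (M : rmodType S) (F : M -> tensor M H) : Prop :=
  forall m s, F (ract m s) = ract (F m) (acoact S s).

HB.mixin Record isHopfModule (k : comPzRingType) (H : hopfAlgType k)
    (S : comodAlgType H) M of RightModule k S M := {
  coact : {linear M -> tensor M H};
  coact_compat : hopf_compatible coact;
  coact_counit : counital (counit H) coact;
  coact_coassoc : coassociative (comul H) coact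
}.

#[short(type="hopfModType")]
HB.structure Definition HopfModule (k : comPzRingType) (H : hopfAlgType k)
    (S : comodAlgType H) :=
  {M of RightModule k S M & isHopfModule k H S M}.

Arguments coact {k H S} s : rename.

Definition hopf_morphism (k : comPzRingType) (H : hopfAlgType k)
    (S : comodAlgType H) (M N : hopfModType S) (f : {linear M -> N}) : Prop :=
  right_linear f /\ forall m, coact N (f m) = tensor_map f idfun (coact M m).

Definition finitely_generated (k : comPzRingType) (P : lmodType k) : Prop :=
  exists (n : nat) (e : 'I_n -> P),
    forall x, exists c : 'I_n -> k, x = \sum_(i < n) c i *: e i.

Definition projective (k : comPzRingType) (P : lmodType k) : Prop :=
  forall (M N : lmodType k) (p : {linear M -> N}) (f : {linear P -> N}),
    (forall y, exists x, p x = y) ->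
    exists g : {linear P -> M}, forall x, p (g x) = f x.

Record rmod_iso (k : comPzRingType) (A : pzAlgType k) (M N : rmodType A) :=
  RmodIso {
    iso_fun :> {linear M -> N};
    iso_inv : {linear N -> M};
    iso_right_linear : right_linear iso_fun;
    iso_funK : cancel iso_fun iso_inv;
    iso_invK : cancel iso_inv iso_fun
  }.

Definition rmod_aut (k : comPzRingType) (A : pzAlgType k) (M : rmodType A) :=
  rmod_iso M M.

Lemma iso_inv_right_linear (k : comPzRingType) (A : pzAlgType k)
  (M N : rmodType A) (f : rmod_iso M N) : right_linear (iso_inv f).
Proof.
move=> n a; apply: (can_inj (iso_funK f)).
by rewrite iso_right_linear !iso_invK.
Qed.

Definition iso_id (k : comPzRingType) (A : pzAlgType k) (M : rmodType A) :
    rmod_aut M :=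
  @RmodIso k A M M idfun idfun (fun _ _ => erefl) (fun _ => erefl)
    (fun _ => erefl).

Definition iso_sym (k : comPzRingType) (A : pzAlgType k) (M N : rmodType A)
    (f : rmod_iso M N) : rmod_iso N M :=
  RmodIso (iso_inv_right_linear f) (iso_invK f) (iso_funK f).

Section IsoComp.
Variables (k : comPzRingType) (A : pzAlgType k) (M N P : rmodType A).
Variables (g : rmod_iso N P) (f : rmod_iso M N).

Lemma iso_comp_right_linear : right_linear (g \o f).
Proof. by move=> m a /=; rewrite !iso_right_linear. Qed.

Definition iso_comp : rmod_iso M P :=
  @RmodIso k A M P (g \o f) (iso_inv f \o iso_inv g) iso_comp_right_linear
    (can_comp (iso_funK g) (iso_funK f)) (can_comp (iso_invK f) (iso_invK g)).
End IsoComp.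

(* The quotient of T by an equivalence relation R, as the set of classes.     *)
Definition quotient_set (T : Type) (R : T -> T -> Prop) : Type :=
  {P : T -> Prop | exists x, P = R x}.

Definition quotient_class (T : Type) (R : T -> T -> Prop) (x : T) :
    quotient_set R :=
  exist _ (R x) (ex_intro _ x erefl).

Lemma quotient_classP (T : Type) (R : T -> T -> Prop) (E : Equivalence R) x y :
  quotient_class R x = quotient_class R y <-> R x y.
Proof.
case: E => rfl sym trans.
split=> [[->]|h]; first exact: rfl.
apply: eq_exist => /=; apply/predeqP => z; split=> h'.
- exact: trans (sym _ _ h) h'.
- exact: trans h h'.
Qed.

Section Descent.
Variables (k : comPzRingType) (H : hopfAlgType k) (S : comodAlgType H).
Variable M : hopfModType S.

(* The elements F of C^1(H, M). *)
Record cocycle1 := Cocycle1 {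
  cocycle1_fun :> {linear M -> tensor M H};
  cocycle1_compat : hopf_compatible cocycle1_fun;
  cocycle1_counit : counital (counit H) cocycle1_fun;
  cocycle1_coassoc : coassociative (comul H) cocycle1_fun
}.

Definition base_cocycle1 : cocycle1 :=
  Cocycle1 (@coact_compat _ _ _ M) (@coact_counit _ _ _ M)
    (@coact_coassoc _ _ _ M).

(* The right action F <- f = (f^-1 (x) id) o F o f of Aut_S(M) on C^1(H, M).  *)
Section Action.
Variables (F : cocycle1) (f : rmod_aut M).

Definition act_fun : M -> tensor M H := tensor_map (iso_inv f) idfun \o F \o f.

HB.instance Definition _ := GRing.Linear.on act_fun.

Lemma act_compat : hopf_compatible act_fun.
Proof.
move=> m s; rewrite /act_fun /= iso_right_linear cocycle1_compat.
set x := (F _); set y := acoact S s.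
have rB : bilin (ract : tensor M H -> tensor S H -> _) := ract_bilin.
elim/tensor_ind: x => [|x x' hx hy|a b].
- by rewrite (bilin0l rB) linear0 /= (bilin0l rB).
- by rewrite (bilinDl rB) !linearD /= (bilinDl rB) hx hy.
elim/tensor_ind: y => [|x x' hx hy|c d].
- by rewrite (bilin0r rB) linear0 /= (bilin0r rB).
- by rewrite (bilinDr rB) linearD /= (bilinDr rB) hx hy.
rewrite [ract (a ⊗ b) _]tensor_ractE !tensor_mapE.
by rewrite [ract (_ ⊗ b) _]tensor_ractE iso_inv_right_linear.
Qed.

Lemma act_counit : counital (counit H) act_fun.
Proof.
by move=> m; rewrite /= tensor_contractr_nat cocycle1_counit iso_funK.
Qed.

Lemma act_coassoc : coassociative (comul H) act_fun.
Proof.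
move=> m; rewrite {2}/act_fun /= tensor_map_comp.
have e : tensor_map (act_fun \o iso_inv f) (idfun \o idfun)
    =1 tensor_map (tensor_map (iso_inv f) idfun \o F) (@idfun H \o idfun).
  by apply: eq_tensor_map => x //=; rewrite /act_fun /= iso_invK.
rewrite e -tensor_map_comp tensor_assoc_nat cocycle1_coassoc /act_fun /=.
rewrite !tensor_map_comp; apply: eq_tensor_map => // x /=.
exact: tensor_map_id.
Qed.

Definition cocycle1_act : cocycle1 :=
  Cocycle1 act_compat act_counit act_coassoc.
End Action.

Definition cohomologous (F F' : cocycle1) : Prop :=
  exists f : rmod_aut M, F' = cocycle1_act F f.

Lemma cocycle1_ext (F F' : cocycle1) : F =1 F' -> F = F'.
Proof.
case: F F' => [[F [[p] [q]]] a b c] [[F' [[p'] [q']]] a' b' c'] /= h.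
have e : F = F' by apply/funext.
case: _ / e p' q' a' b' c' {h} => p' q'.
rewrite (Prop_irrelevance p' p) (Prop_irrelevance q' q) => a' b' c'.
by congr Cocycle1; apply: Prop_irrelevance.
Qed.

Lemma cocycle1_act1 F : cocycle1_act F (iso_id M) = F.
Proof. by apply: cocycle1_ext => m; apply: tensor_map_id. Qed.

Lemma cocycle1_actM F f g :
  cocycle1_act F (iso_comp f g) = cocycle1_act (cocycle1_act F f) g.
Proof.
apply: cocycle1_ext => m; rewrite /= /act_fun /= tensor_map_comp.
exact: eq_tensor_map.
Qed.

Lemma cohomologous_equiv : Equivalence cohomologous.
Proof.
split=> [F|F _ [f ->]|F _ _ [f ->] [g ->]].
- by exists (iso_id M); rewrite cocycle1_act1.
- exists (iso_sym f); rewrite -cocycle1_actM; apply: cocycle1_ext => m.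
  rewrite /= /act_fun /= iso_invK -[LHS]tensor_map_id.
  by apply: eq_tensor_map => // x /=; rewrite iso_invK.
- by exists (iso_comp f g); rewrite cocycle1_actM.
Qed.

Definition D1 : Type := quotient_set cohomologous.
Definition D1_base : D1 := quotient_class cohomologous base_cocycle1.

(* torsor_mod bundles X with Delta_X; torsor_iso is beta. *)
Record torsor := Torsor {
  torsor_mod : hopfModType S;
  torsor_iso : rmod_iso M torsor_mod
}.

Definition trivial_torsor : torsor := Torsor (iso_id M).

Definition torsor_equiv (X X' : torsor) : Prop :=
  exists f : rmod_aut M,
    hopf_morphism (torsor_iso X \o f \o iso_inv (torsor_iso X')).

Lemma torsor_equiv_equiv : Equivalence torsor_equiv.
Proof.
split=> [X|X Y [f [_ h]]|X Y Z [f [_ hf]] [g [_ hg]]].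
- exists (iso_id M); split=> [m a|m] /=.
    by rewrite iso_inv_right_linear iso_right_linear.
  rewrite iso_invK -[LHS]tensor_map_id.
  by apply: eq_tensor_map => // x /=; rewrite iso_invK.
- exists (iso_sym f); split=> [m a|m] /=.
    by rewrite !(iso_inv_right_linear, iso_right_linear).
  have := h (torsor_iso Y (iso_inv f (iso_inv (torsor_iso X) m))).
  rewrite /= iso_funK !iso_invK => ->.
  rewrite tensor_map_comp -[LHS]tensor_map_id.
  by apply: eq_tensor_map => // x /=; rewrite !iso_funK iso_invK.
- exists (iso_comp f g); split=> [m a|m] /=.
    by rewrite !(iso_inv_right_linear, iso_right_linear).
  have := hf (torsor_iso Y (g (iso_inv (torsor_iso Z) m))).
  rewrite /= iso_funK => ->; rewrite hg tensor_map_comp.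
  by apply: eq_tensor_map => // x /=; rewrite iso_funK.
Qed.

Definition Tors : Type := quotient_set torsor_equiv.
Definition Tors_base : Tors := quotient_class torsor_equiv trivial_torsor.

End Descent.

(* Main.v *)
Require Import Defs.
From mathcomp Require Import all_boot all_algebra.
From HB Require Import structures.
From mathcomp Require Import boolp.
From Stdlib Require Import RelationClasses.

(** Descent cocycles are exactly the coactions that make the S-module M into a
    Hopf module, so a cocycle F yields the torsor (M, F, id).  Conversely the
    isomorphism beta of a torsor (X, Delta_X, beta) pulls Delta_X back to the
    cocycle F_X = (beta^-1 (x) id) o Delta_X o beta, and the pullback of
    (M, F, id) is F again.  Cancelling the bijections beta and beta' in
      Delta_X o (beta f beta'^-1) = ((beta f beta'^-1) (x) id) o Delta_X'
    turns it into F_X' = (f^-1 (x) id) o F_X o f: the automorphisms f that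
    witness an equivalence of two torsors are exactly those that carry the
    cocycle of the first to that of the second
    ([torsor_equiv_cohomologous]).  Pulling back is thus a surjection from
    torsors to cocycles under which the two relations correspond, and the
    bijection between quotients is formal ([quotient_set_bij]). *)

Set Implicit Arguments.
Unset Strict Implicit.
Unset Printing Implicit Defensive.

Import GRing.Theory.
Local Open Scope ring_scope.

Section QuotientBijection.
Variables (T T' : Type) (R : T -> T -> Prop) (R' : T' -> T' -> Prop).
Hypotheses (RE : Equivalence R) (RE' : Equivalence R').

Lemma quotient_class_surj (U : Type) (Q : U -> U -> Prop)
  (c : quotient_set Q) : exists x, c = quotient_class Q x.
Proof. by case: c => P [x e]; exists x; apply: eq_exist. Qed.

(** R x y and R' (p x) (p y) being equivalent, p descends to an injection,
    which is onto because p has a section g.  The bijection returned is the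
    one induced by g, so that it sends the class of y to that of g y. *)
Lemma quotient_set_bij (p : T -> T') (g : T' -> T) :
    (forall x y, R x y <-> R' (p x) (p y)) -> cancel g p ->
  exists phi : quotient_set R' -> quotient_set R,
    bijective phi /\ forall y, phi (quotient_class R' y) = quotient_class R (g y).
Proof.
move=> pR gK.
pose phi (c : quotient_set R') := quotient_class R (g (sval (cid (quotient_class_surj c)))).
pose psi (c : quotient_set R) := quotient_class R' (p (sval (cid (quotient_class_surj c)))).
have phiE y : phi (quotient_class R' y) = quotient_class R (g y).
  rewrite /phi; case: cid => z /= /(quotient_classP RE') yz.
  by apply/(quotient_classP RE)/pR; rewrite !gK; case: RE' => _ sym _; apply: sym.
have psiE x : psi (quotient_class R x) = quotient_class R' (p x).
  rewrite /psi; case: cid => z /= /(quotient_classP RE) xz.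
  by apply/(quotient_classP RE')/pR; case: RE => _ sym _; apply: sym.
exists phi; split=> //; exists psi => c.
- by have [y ->] := quotient_class_surj c; rewrite phiE psiE gK.
- have [x ->] := quotient_class_surj c; rewrite psiE phiE.
  by apply/(quotient_classP RE)/pR; rewrite gK; case: RE' => rfl _ _; apply: rfl.
Qed.
End QuotientBijection.

Lemma tensor_map_ract (k : comPzRingType) (A B : pzAlgType k) (M N : rmodType A)
    (f : {linear M -> N}) (x : tensor M B) (y : tensor A B) :
  right_linear f ->
  tensor_map f idfun (ract x y) = ract (tensor_map f idfun x) y.
Proof.
move=> fr.
have rM : bilin (ract : tensor M B -> tensor A B -> _) := ract_bilin.
have rN : bilin (ract : tensor N B -> tensor A B -> _) := ract_bilin.
elim/tensor_ind: x => [|x x' hx hy|m b].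
- by rewrite (bilin0l rM) linear0 (bilin0l rN).
- by rewrite (bilinDl rM) !linearD /= (bilinDl rN) hx hy.
elim/tensor_ind: y => [|y y' hx hy|a b'].
- by rewrite (bilin0r rM) linear0 (bilin0r rN).
- by rewrite (bilinDr rM) linearD /= (bilinDr rN) hx hy.
rewrite [ract (m ⊗ b) _]tensor_ractE !tensor_mapE.
by rewrite [ract (_ ⊗ b) _]tensor_ractE fr.
Qed.

Lemma tensor_map_iso_funK (k : comPzRingType) (A : pzAlgType k)
    (M N : rmodType A) (P : lmodType k) (f : rmod_iso M N) :
  cancel (tensor_map f (@idfun P)) (tensor_map (iso_inv f) idfun).
Proof.
move=> x; rewrite tensor_map_comp -[RHS]tensor_map_id.
by apply: eq_tensor_map => // m /=; rewrite iso_funK.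
Qed.

Section TorsorCocycle.
Variables (k : comPzRingType) (H : hopfAlgType k) (S : comodAlgType H).
Variable M : hopfModType S.

Section Pullback.
Variable X : torsor M.
Let beta := torsor_iso X.

Definition pullback_fun : M -> tensor M H :=
  tensor_map (iso_inv beta) idfun \o coact (torsor_mod X) \o beta.

HB.instance Definition _ := GRing.Linear.on pullback_fun.

Lemma pullback_compat : hopf_compatible pullback_fun.
Proof.
move=> m s; rewrite /pullback_fun /= iso_right_linear coact_compat.
exact/tensor_map_ract/iso_inv_right_linear.
Qed.

Lemma pullback_counit : counital (counit H) pullback_fun.
Proof. by move=> m; rewrite /= tensor_contractr_nat coact_counit iso_funK. Qed.

(** Applying the pullback twice brings beta next to beta^-1, so only one
    beta^-1 survives on the left and coassociativity of Delta_X applies. *)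
Lemma pullback_coassoc : coassociative (comul H) pullback_fun.
Proof.
move=> m; rewrite {2}/pullback_fun /= tensor_map_comp.
have e : tensor_map (pullback_fun \o iso_inv beta) (idfun \o idfun)
    =1 tensor_map (tensor_map (iso_inv beta) idfun \o coact (torsor_mod X))
         (@idfun H \o idfun).
  by apply: eq_tensor_map => x //=; rewrite /pullback_fun /= iso_invK.
rewrite e -tensor_map_comp tensor_assoc_nat coact_coassoc /pullback_fun /=.
by rewrite !tensor_map_comp; apply: eq_tensor_map => // x; apply: tensor_map_id.
Qed.

Definition torsor_cocycle : cocycle1 M :=
  Cocycle1 pullback_compat pullback_counit pullback_coassoc.

Lemma torsor_cocycleK m :
  tensor_map beta idfun (torsor_cocycle m) = coact (torsor_mod X) (beta m).
Proof. exact: (tensor_map_iso_funK (iso_sym beta)). Qed.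
End Pullback.

(** In Delta_X o (beta f beta'^-1) = ((beta f beta'^-1) (x) id) o Delta_Y, every
    element of Y is beta' m for some m, and each coaction is its pulled-back
    cocycle conjugated by beta or beta'.  Only the injective map beta (x) id
    is then left to cancel, which gives F_X o f = (f (x) id) o F_Y. *)
Lemma torsor_equiv_cohomologous (X Y : torsor M) :
  torsor_equiv X Y <-> cohomologous (torsor_cocycle X) (torsor_cocycle Y).
Proof.
have transfer (f : rmod_aut M) m :
    tensor_map (torsor_iso X \o f \o iso_inv (torsor_iso Y)) idfun
      (coact (torsor_mod Y) (torsor_iso Y m))
    = tensor_map (torsor_iso X) idfun
        (tensor_map f idfun (torsor_cocycle Y m)).
  rewrite -torsor_cocycleK !tensor_map_comp.
  by apply: eq_tensor_map => // x /=; rewrite iso_funK.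
split=> -[f].
- case=> _ h; exists f; apply: cocycle1_ext => m.
  have := h (torsor_iso Y m).
  rewrite transfer /= iso_funK -torsor_cocycleK.
  move=> /(can_inj (tensor_map_iso_funK (torsor_iso X))) e.
  by rewrite /act_fun /= [X in tensor_map _ _ X]e tensor_map_iso_funK.
- move=> e; exists f; split=> [m a|y] /=.
    by rewrite !(iso_inv_right_linear, iso_right_linear).
  rewrite -[y in RHS](iso_invK (torsor_iso Y)) transfer -torsor_cocycleK.
  by rewrite e [tensor_map f _ _](tensor_map_iso_funK (iso_sym f)).
Qed.

(** A copy of M, to carry F as its coaction in place of the one of M. *)
Definition twist (F : cocycle1 M) : Type := M.

Section Twist.
Variable F : cocycle1 M.
HB.instance Definition _ := RightModule.copy (twist F) M.
HB.instance Definition _ := isHopfModule.Build k H S (twist F)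
  (cocycle1_compat F) (cocycle1_counit F) (cocycle1_coassoc F).

Definition cocycle_torsor : torsor M :=
  @Torsor _ _ _ M (twist F) (iso_id M).
End Twist.

Lemma cocycle_torsorK : cancel cocycle_torsor torsor_cocycle.
Proof. by move=> F; apply: cocycle1_ext => m; apply: tensor_map_id. Qed.
End TorsorCocycle.

Theorem proposition2p8 (k : comPzRingType) (H : hopfAlgType k)
    (H_fg : finitely_generated H) (H_proj : projective H)
    (S : comodAlgType H) (M : hopfModType S) :
  exists phi : D1 M -> Tors M,
    bijective phi /\ phi (D1_base M) = Tors_base M.
Proof.
have [phi [phi_bij phiE]] :=
  quotient_set_bij (torsor_equiv_equiv M) (cohomologous_equiv M)
    (@torsor_equiv_cohomologous _ _ _ M) (@cocycle_torsorK _ _ _ M).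
exists phi; split=> //; rewrite /D1_base phiE.
apply/(quotient_classP (torsor_equiv_equiv M)).
(* The twist of M by its own coaction is M itself, up to the identity map. *)
exists (iso_id M); split=> // m /=.
by rewrite [RHS]tensor_map_id.
Qed.
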